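(* Let $p>0$ be a prime number and let $A$ be a $p$-adically complete ring with a nonzero divisor $\varpi\in A$. Assume that $\varpi$ admits a compatible system of $p$-power roots $\varpi^{1/p^n}\in A$ ($n\ge 1$), that $p\in\varpi^pA$, and that $A/pA$ is semiperfect. Let $\varpi^\flat:=(\ldots,\varpi^{1/p^2},\varpi^{1/p},\varpi)\in A^\flat$ be the corresponding element of the tilt $A^\flat$. If $A$ is integrally closed in $A[\frac{1}{\varpi}]$, then $A^\flat$ is integrally closed in $A^\flat[\frac{1}{\varpi^\flat}]$.
   Context: All rings are commutative with $1$, not necessarily Noetherian. ''$I$-adically complete'' always includes ''$I$-adically separated''. A compatible system of $p$-power roots of $\varpi$ in $A$ means elements $\varpi^{1/p^n}\in A$ ($n\ge 0$) with $\varpi^{1/p^0}=\varpi$ and $(\varpi^{1/p^{n+1}})^p=\varpi^{1/p^n}$ for all $n\ge 0$. The ring $A/pA$ is semiperfect if its Frobenius map $x\mapsto x^p$ is surjective. The tilt of $A$ is the ring $A^\flat:=\varprojlim\{\cdots\to A/pA\to A/pA\}$, where every transition map is the Frobenius map $x\mapsto x^p$ on $A/pA$; its elements are written $(\ldots,a_1,a_0)$ with $a_n\in A/pA$ and $a_{n+1}^p=a_n$. The element $\varpi^\flat\in A^\flat$ is the sequence of residue classes modulo $p$ of the $\varpi^{1/p^n}$. *)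

(* Defs.v *)
(* Rings are [comPzRingType]s, so that the zero ring is allowed. *)
From HB Require Import structures.
From mathcomp Require Import all_boot all_algebra.
From mathcomp Require Import ring_quotient generic_quotient.
From mathcomp Require Import boolp functions.
From mathcomp Require Import ring.

Set Implicit Arguments.
Unset Strict Implicit.
Unset Printing Implicit Defensive.

Import GRing.Theory.

Local Open Scope ring_scope.
Local Open Scope quotient_scope.

Section Principal.
Variables (R : comPzRingType) (x : R).

Definition principal : {pred R} := fun a => `[< exists b, a = x * b >].

Lemma principalP a : reflect (exists b, a = x * b) (a \in principal).
Proof. exact: asboolP. Qed.

Lemma principal_zmod_closed : zmod_closed principal.
Proof.
split; first by apply/principalP; exists 0; rewrite mulr0.
move=> _ _ /principalP[b ->] /principalP[c ->].
by apply/principalP; exists (b - c); rewrite mulrBr.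
Qed.

HB.instance Definition _ :=
  GRing.isZmodClosed.Build R principal principal_zmod_closed.

Lemma principalMl a u : u \in principal -> a * u \in principal.
Proof.
by move=> /principalP[b ->]; apply/principalP; exists (a * b); rewrite mulrCA.
Qed.

(* The ring structure of [{ideal_quot _}] requires a proper ideal in a nonzero
   ring, hence only the additive quotient of the library is reused. *)
Definition quo : Type := {ideal_quot principal}.

HB.instance Definition _ := GRing.Zmodule.on quo.
HB.instance Definition _ := EqQuotient.on quo.

Definition to_quo (a : R) : quo := \pi_{ideal_quot principal} a.

Lemma to_quo_eq a b : to_quo a = to_quo b <-> a - b \in principal.
Proof.
rewrite (Quotient.idealrBE principal).
by split=> [h | /eqP h]; first apply/eqP.
Qed.

Lemma to_quo_surj (u : quo) : exists a, to_quo a = u.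
Proof. by exists (repr (u : {ideal_quot principal})); rewrite /to_quo reprK. Qed.

Definition quo_one : quo := to_quo 1.
Definition quo_mul (u v : quo) : quo :=
  to_quo (repr (u : {ideal_quot principal}) * repr (v : {ideal_quot principal})).

Lemma to_quo_mul a b : to_quo (a * b) = quo_mul (to_quo a) (to_quo b).
Proof.
apply/to_quo_eq; set a' := repr _; set b' := repr _.
have ha : a - a' \in principal by apply/to_quo_eq; rewrite /to_quo reprK.
have hb : b - b' \in principal by apply/to_quo_eq; rewrite /to_quo reprK.
have -> : a * b - a' * b' = b * (a - a') + a' * (b - b').
  by rewrite !mulrBr [b * a]mulrC [b * a']mulrC addrA subrK.
by rewrite rpredD // principalMl.
Qed.

Lemma to_quo_add a b : to_quo (a + b) = to_quo a + to_quo b.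
Proof. exact: (raddfD (\pi_{ideal_quot principal})). Qed.

Lemma quo_mulA : associative quo_mul.
Proof.
move=> u v w; have [a <-] := to_quo_surj u; have [b <-] := to_quo_surj v.
by have [c <-] := to_quo_surj w; rewrite -!to_quo_mul mulrA.
Qed.

Lemma quo_mulC : commutative quo_mul.
Proof.
move=> u v; have [a <-] := to_quo_surj u; have [b <-] := to_quo_surj v.
by rewrite -!to_quo_mul mulrC.
Qed.

Lemma quo_mul1 : left_id quo_one quo_mul.
Proof. by move=> u; have [a <-] := to_quo_surj u; rewrite -to_quo_mul mul1r. Qed.

Lemma quo_mulD : left_distributive quo_mul +%R.
Proof.
move=> u v w; have [a <-] := to_quo_surj u; have [b <-] := to_quo_surj v.
have [c <-] := to_quo_surj w.
by rewrite -to_quo_add -!to_quo_mul -to_quo_add mulrDl.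
Qed.

HB.instance Definition _ :=
  GRing.Zmodule_isComPzRing.Build quo quo_mulA quo_mulC quo_mul1 quo_mulD.

Lemma to_quo_is_zmod_morphism : zmod_morphism to_quo.
Proof. exact: (raddfB (\pi_{ideal_quot principal})). Qed.

Lemma to_quo_is_monoid_morphism : monoid_morphism to_quo.
Proof. by split=> // a b; rewrite to_quo_mul. Qed.

HB.instance Definition _ :=
  GRing.isZmodMorphism.Build R quo to_quo to_quo_is_zmod_morphism.
HB.instance Definition _ :=
  GRing.isMonoidMorphism.Build R quo to_quo to_quo_is_monoid_morphism.

End Principal.

(* [x]-adically separated, and every [x]-adic Cauchy sequence converges. *)
Definition adically_complete (R : comPzRingType) (x : R) : Prop :=
  (forall a : R, (forall n, a \in principal (x ^+ n)) -> a = 0) /\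
  (forall u : nat -> R,
     (forall m n, (m <= n)%N -> u n - u m \in principal (x ^+ m)) ->
     exists a, forall n, u n - a \in principal (x ^+ n)).

Definition semiperfect (p : nat) (R : comPzRingType) : Prop :=
  forall y : R, exists x, x ^+ p = y.

(* The ring R[1/f]: classes of pairs (a, n), standing for a / f ^ n. *)
Section Localization.
Variables (R : comPzRingType) (f : R).

Definition loc_equiv : rel (R * nat) := fun u v =>
  `[< exists k, f ^+ k * (u.1 * f ^+ v.2) = f ^+ k * (v.1 * f ^+ u.2) >].

Lemma loc_equiv_is_equiv : equiv_class_of loc_equiv.
Proof.
split=> [u|u v|v u w].
- by apply/asboolP; exists 0.
- by apply/asboolP/asboolP => -[k hk]; exists k.
move=> /asboolP[k hk] /asboolP[l hl]; apply/asboolP; exists (k + l + v.2)%N.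
have e1 : f ^+ (k + l + v.2) * (u.1 * f ^+ w.2)
        = f ^+ l * f ^+ w.2 * (f ^+ k * (u.1 * f ^+ v.2)).
  by rewrite !exprD; ring.
have e2 : f ^+ (k + l + v.2) * (w.1 * f ^+ u.2)
        = f ^+ k * f ^+ u.2 * (f ^+ l * (w.1 * f ^+ v.2)).
  by rewrite !exprD; ring.
by rewrite e1 e2 hk -hl; ring.
Qed.

Canonical loc_equiv_equiv := EquivRelPack loc_equiv_is_equiv.
Canonical loc_equiv_encModRel := defaultEncModRel loc_equiv.

Definition loc : Type := {eq_quot loc_equiv}.

HB.instance Definition _ := Choice.on loc.
HB.instance Definition _ := EqQuotient.on loc.

Definition frac (a : R) (n : nat) : loc := \pi_{eq_quot loc_equiv} (a, n).

Lemma frac_eq a b m n : frac a m = frac b n <->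
  exists k, f ^+ k * (a * f ^+ n) = f ^+ k * (b * f ^+ m).
Proof.
rewrite /frac; split=> [/eqP|h]; first by rewrite piE => /asboolP.
by apply/eqP; rewrite piE; apply/asboolP.
Qed.

Lemma fracP (u : loc) : exists a n, u = frac a n.
Proof.
exists (repr (u : {eq_quot loc_equiv})).1, (repr (u : {eq_quot loc_equiv})).2.
by rewrite /frac -surjective_pairing reprK.
Qed.

Definition loc_add (u v : loc) : loc :=
  let a := repr (u : {eq_quot loc_equiv}) in
  let b := repr (v : {eq_quot loc_equiv}) in
  frac (a.1 * f ^+ b.2 + b.1 * f ^+ a.2) (a.2 + b.2).

Definition loc_opp (u : loc) : loc :=
  let a := repr (u : {eq_quot loc_equiv}) in frac (- a.1) a.2.

Definition loc_mul (u v : loc) : loc :=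
  let a := repr (u : {eq_quot loc_equiv}) in
  let b := repr (v : {eq_quot loc_equiv}) in
  frac (a.1 * b.1) (a.2 + b.2).

Lemma repr_frac a n : exists b m,
  repr (frac a n : {eq_quot loc_equiv}) = (b, m) /\
  exists k, f ^+ k * (b * f ^+ n) = f ^+ k * (a * f ^+ m).
Proof.
case e: (repr _) => [b m]; exists b, m; split=> //.
by apply/frac_eq; rewrite /frac -e reprK.
Qed.

Lemma loc_addE a b m n :
  loc_add (frac a m) (frac b n) = frac (a * f ^+ n + b * f ^+ m) (m + n).
Proof.
rewrite /loc_add; have [a' [m' [-> [k hk]]]] := repr_frac a m.
have [b' [n' [-> [l hl]]]] := repr_frac b n.
apply/frac_eq; exists (k + l)%N => /=; rewrite !exprD.
transitivity (f ^+ l * f ^+ n * f ^+ n' * (f ^+ k * (a' * f ^+ m))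
  + f ^+ k * f ^+ m * f ^+ m' * (f ^+ l * (b' * f ^+ n))); first by ring.
by rewrite hk hl; ring.
Qed.

Lemma loc_oppE a m : loc_opp (frac a m) = frac (- a) m.
Proof.
rewrite /loc_opp; have [a' [m' [-> [k hk]]]] := repr_frac a m.
by apply/frac_eq; exists k; rewrite /= !mulNr !mulrN hk.
Qed.

Lemma loc_mulE a b m n : loc_mul (frac a m) (frac b n) = frac (a * b) (m + n).
Proof.
rewrite /loc_mul; have [a' [m' [-> [k hk]]]] := repr_frac a m.
have [b' [n' [-> [l hl]]]] := repr_frac b n.
apply/frac_eq; exists (k + l)%N => /=; rewrite !exprD.
transitivity ((f ^+ k * (a' * f ^+ m)) * (f ^+ l * (b' * f ^+ n))).
  by ring.
by rewrite hk hl; ring.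
Qed.

Lemma frac_eqW a b m n : a * f ^+ n = b * f ^+ m -> frac a m = frac b n.
Proof. by move=> h; apply/frac_eq; exists 0; rewrite h. Qed.

Lemma loc_addA : associative loc_add.
Proof.
move=> u v w; have [a [m ->]] := fracP u; have [b [n ->]] := fracP v.
have [c [q ->]] := fracP w; rewrite !loc_addE; apply: frac_eqW.
by rewrite !exprD; ring.
Qed.

Lemma loc_addC : commutative loc_add.
Proof.
move=> u v; have [a [m ->]] := fracP u; have [b [n ->]] := fracP v.
by rewrite !loc_addE addrC addnC.
Qed.

Lemma loc_add0 : left_id (frac 0 0) loc_add.
Proof.
by move=> u; have [a [m ->]] := fracP u; rewrite loc_addE mul0r add0r mulr1.
Qed.

Lemma loc_addN : left_inverse (frac 0 0) loc_opp loc_add.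
Proof.
move=> u; have [a [m ->]] := fracP u; rewrite loc_oppE loc_addE.
by apply: frac_eqW; rewrite mulNr addNr !mul0r.
Qed.

Lemma loc_mulA : associative loc_mul.
Proof.
move=> u v w; have [a [m ->]] := fracP u; have [b [n ->]] := fracP v.
by have [c [q ->]] := fracP w; rewrite !loc_mulE mulrA addnA.
Qed.

Lemma loc_mulC : commutative loc_mul.
Proof.
move=> u v; have [a [m ->]] := fracP u; have [b [n ->]] := fracP v.
by rewrite !loc_mulE mulrC addnC.
Qed.

Lemma loc_mul1 : left_id (frac 1 0) loc_mul.
Proof. by move=> u; have [a [m ->]] := fracP u; rewrite loc_mulE mul1r. Qed.

Lemma loc_mulD : left_distributive loc_mul loc_add.
Proof.
move=> u v w; have [a [m ->]] := fracP u; have [b [n ->]] := fracP v.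
have [c [q ->]] := fracP w; rewrite !(loc_addE, loc_mulE); apply: frac_eqW.
by rewrite !exprD; ring.
Qed.

HB.instance Definition _ :=
  GRing.isZmodule.Build loc loc_addA loc_addC loc_add0 loc_addN.
HB.instance Definition _ :=
  GRing.Zmodule_isComPzRing.Build loc loc_mulA loc_mulC loc_mul1 loc_mulD.

Definition to_loc (a : R) : loc := frac a 0.

Lemma to_loc_is_zmod_morphism : zmod_morphism to_loc.
Proof.
move=> a b; rewrite /to_loc -[RHS]/(loc_add _ (loc_opp _)) loc_oppE loc_addE.
by rewrite !mulr1.
Qed.

Lemma to_loc_is_monoid_morphism : monoid_morphism to_loc.
Proof.
by split=> // a b; rewrite /to_loc -[RHS]/(loc_mul _ _) loc_mulE.
Qed.

HB.instance Definition _ :=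
  GRing.isZmodMorphism.Build R loc to_loc to_loc_is_zmod_morphism.
HB.instance Definition _ :=
  GRing.isMonoidMorphism.Build R loc to_loc to_loc_is_monoid_morphism.

Lemma fracE a n : frac a n * to_loc f ^+ n = to_loc a.
Proof.
rewrite -rmorphXn -[LHS]/(loc_mul _ _) loc_mulE addn0.
by apply: frac_eqW; rewrite mulr1.
Qed.

End Localization.

(* [integralOver] of mxpoly.v needs nonzero rings; [n] and [c] give the monic
   polynomial X^n + c_(n-1) X^(n-1) + ... + c_0. *)
Definition integral_elt (R S : comPzRingType) (g : {rmorphism R -> S}) (s : S) :=
  exists (n : nat) (c : nat -> R), s ^+ n + \sum_(i < n) g (c i) * s ^+ i = 0.

(* [R] is viewed as a subring of [S] through [g], hence the injectivity. *)
Definition integrally_closed_in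
    (R S : comPzRingType) (g : {rmorphism R -> S}) : Prop :=
  injective g /\ forall s, integral_elt g s -> exists r, g r = s.

Lemma exprDp_pz (p : nat) (R : comPzRingType) (x y : R) :
  prime p -> p%:R = 0 :> R -> (x + y) ^+ p = x ^+ p + y ^+ p.
Proof.
case: p => // p p_prime p0.
rewrite exprDn big_ord_recl big_ord_recr /= bin0 binn subn0 subnn.
rewrite !mulr1n mulr1 mul1r big1 ?add0r // => i _.
have /dvdnP[q ->] : (p.+1 %| 'C(p.+1, bump 0 i))%N.
  by apply: prime_dvd_bin => //=; rewrite /bump add1n /= ltnS ltn_ord.
by rewrite mulrnA -[_ *+ p.+1]mulr_natr p0 mulr0.
Qed.

Section Tilt.
Variables (p : nat) (p_prime : prime p) (A : comPzRingType).

Local Notation Ap := (quo (p%:R : A)).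

Lemma quo_p_eq0 : p%:R = 0 :> Ap.
Proof.
rewrite -(rmorph_nat (to_quo p%:R)) -(rmorph0 (to_quo p%:R)).
by apply/to_quo_eq; rewrite subr0; apply/principalP; exists 1; rewrite mulr1.
Qed.

Lemma quo_FrobeniusD (x y : Ap) : (x + y) ^+ p = x ^+ p + y ^+ p.
Proof. exact: exprDp_pz p_prime quo_p_eq0. Qed.

(* A point of the limit is a sequence [a] with [a n] in the n-th copy of A/pA. *)
Definition tilt_seq : {pred nat -> Ap} :=
  fun a => `[< forall n, a n.+1 ^+ p = a n >].

Lemma tilt_seqP a :
  reflect (forall n, a n.+1 ^+ p = a n) (a \in tilt_seq).
Proof. exact: asboolP. Qed.

Lemma tilt_subring_closed : subring_closed tilt_seq.
Proof.
split=> [|a b /tilt_seqP ha /tilt_seqP hb|a b /tilt_seqP ha /tilt_seqP hb].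
- by apply/tilt_seqP => n; exact: expr1n.
- apply/tilt_seqP => n.
  have e : (a n.+1 - b n.+1) ^+ p + b n.+1 ^+ p = a n.+1 ^+ p.
    by rewrite -quo_FrobeniusD subrK.
  rewrite -[LHS]/((a n.+1 - b n.+1) ^+ p) -[RHS]/(a n - b n).
  by rewrite -(ha n) -(hb n) -e addrK.
by apply/tilt_seqP => n; rewrite -[RHS]/(a n * b n) -(ha n) -(hb n) -exprMn.
Qed.

End Tilt.

(* The parameter [p_prime] lets the ring structure below be inferred. *)
Record tilt (p : nat) (p_prime : prime p) (A : comPzRingType) := Tilt {
  tilt_val :> nat -> quo (p%:R : A);
  _ : tilt_val \in @tilt_seq p A
}.

Section TiltRing.
Variables (p : nat) (p_prime : prime p) (A : comPzRingType).

HB.instance Definition _ := [isSub for @tilt_val p p_prime A].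
HB.instance Definition _ := [Choice of tilt p_prime A by <:].
HB.instance Definition _ :=
  GRing.SubChoice_isSubComPzRing.Build (nat -> quo (p%:R : A))
    (@tilt_seq p A) (tilt p_prime A) (tilt_subring_closed p_prime A).

End TiltRing.

Definition compatible_roots (p : nat) (A : comPzRingType) (w : A)
    (r : nat -> A) : Prop :=
  r 0 = w /\ forall n, r n.+1 ^+ p = r n.

Lemma compatible_roots_tilt (p : nat) (A : comPzRingType) (w : A)
    (r : nat -> A) :
  compatible_roots p w r -> (fun n => to_quo p%:R (r n)) \in @tilt_seq p A.
Proof. by move=> [_ hr]; apply/tilt_seqP => n; rewrite -rmorphXn hr. Qed.

Definition tilt_of_roots (p : nat) (p_prime : prime p) (A : comPzRingType)
    (w : A) (r : nat -> A) (hr : compatible_roots p w r) : tilt p_prime A :=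
  @Tilt p p_prime A _ (compatible_roots_tilt hr).

(* Main.v *)
From HB Require Import structures.
Require Import Defs.
From mathcomp Require Import all_boot all_algebra.
From mathcomp Require Import boolp functions ring.

Set Implicit Arguments.
Unset Strict Implicit.

Import GRing.Theory.
Local Open Scope ring_scope.

(** Write A/p for the quotient of A by p, r_n for the root of w of order p^n,
    and t for the element (..., r_1, r_0) of the tilt.  An element of the
    tilt is a sequence in A/p, and reading it at a later index n amounts to
    extracting a root of order p^n.  Two facts make this reading faithful
    enough.

    Since p lies in w^p A with p >= 2, dividing p by a divisor u of w leaves an
    element whose square is still a multiple of p.  Hence the u-torsion of A/p
    consists of elements of square zero (torsion_sqr_eq0) and is killed by the
    Frobenius: equalities that hold in A/p after multiplication by u become
    honest equalities one index lower.  Taking u = r_n, this shows that t is a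
    nonzero divisor (tilt_root_lreg).

    Let now g / t^k be integral over the tilt, of degree d.  After clearing
    denominators, the equation says at index n that a lift G of g_n satisfies,
    modulo p, the equation expressing that G / r_n^k is integral.  When
    p^n >= k d, the power (r_n^k)^d divides w, hence p, so the error term can be
    absorbed in the constant coefficient and G / r_n^k is integral over A
    itself.  As A is integrally closed in A[1/w], r_n^k divides G
    (integral_dvd).  The quotients of the g_n by the r_n^k obtained in this way
    are compatible only up to r_n^k-torsion, which a Frobenius kills; they thus
    define an element of the tilt whose product with t^k is g
    (tilt_dvd_root). *)

(** * Localization and monic equations *)

Lemma to_loc_inj (R : comPzRingType) (f : R) :
  GRing.lreg f -> injective (to_loc f).
Proof.
move=> f_reg a b /frac_eq[k]; rewrite !expr0 !mulr1.
by apply: lregX.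
Qed.

(** Homogenization: a monic polynomial at [s], multiplied by [u ^+ n], becomes a
    monic polynomial at [u * s]. *)
Lemma scale_monic (S : comPzRingType) (n : nat) (c : nat -> S) (u s : S) :
  u ^+ n * (s ^+ n + \sum_(i < n) c i * s ^+ i) =
  (u * s) ^+ n + \sum_(i < n) c i * u ^+ (n - i) * (u * s) ^+ i.
Proof.
rewrite mulrDr exprMn mulr_sumr; congr (_ + _); apply: eq_bigr => i _.
by rewrite -{1}(subnK (ltnW (ltn_ord i))) exprD exprMn; ring.
Qed.

(** The degree of an integral equation can be taken positive, so that there is
    a constant coefficient to modify. *)
Lemma integral_elt_pos (R S : comPzRingType) (g : {rmorphism R -> S}) (s : S) :
  integral_elt g s ->
  exists (n : nat) (c : nat -> R),
    s ^+ n.+1 + \sum_(i < n.+1) g (c i) * s ^+ i = 0.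
Proof.
move=> [n [c hc]]; exists n, (fun i => if i is j.+1 then c j else 0).
rewrite big_ord_recl rmorph0 mul0r add0r.
rewrite -[RHS](mulr0 s) -[in RHS]hc mulrDr mulr_sumr exprS; congr (_ + _).
by apply: eq_bigr => i _ /=; rewrite /bump add1n exprS mulrCA.
Qed.

Lemma integral_frac_eq (R : comPzRingType) (f g : R) (k : nat) :
  GRing.lreg f -> integral_elt (to_loc f) (Defs.frac f g k) ->
  exists (n : nat) (c : nat -> R),
    g ^+ n.+1 + \sum_(i < n.+1) c i * (f ^+ k) ^+ (n.+1 - i) * g ^+ i = 0.
Proof.
move=> f_reg /integral_elt_pos[n [c hc]]; exists n, c.
apply: (to_loc_inj f_reg); rewrite rmorph0.
move: (@scale_monic _ n.+1 (fun i => to_loc f (c i)) (to_loc f f ^+ k)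
  (Defs.frac f g k)).
rewrite hc mulr0 [_ ^+ k * _]mulrC fracE => ->.
rewrite rmorphD rmorphXn rmorph_sum; congr (_ + _); apply: eq_bigr => i _.
by rewrite !rmorphM !rmorphXn.
Qed.

(** As [u] divides [w], it is invertible in the localization at [w].  Divided by
    [u ^+ n.+1], the equation becomes one for [x / u] in which [e] only changes
    the constant coefficient; so [x / u] is integral, hence lies in [R]. *)
Lemma integral_dvd (R : comPzRingType) (w u v x e : R) (n : nat)
    (c : nat -> R) :
  integrally_closed_in (to_loc w) -> w = u * v ->
  x ^+ n.+1 + \sum_(i < n.+1) c i * u ^+ (n.+1 - i) * x ^+ i = u ^+ n.+1 * e ->
  exists y, x = u * y.
Proof.
move=> [inj closed] wuv hx.
have u_inv : to_loc w u * (to_loc w v * Defs.frac w 1 1) = 1.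
  have w_inv : Defs.frac w 1 1 * to_loc w w = 1.
    by rewrite -[to_loc w w]expr1 fracE rmorph1.
  by rewrite mulrA -rmorphM -wuv mulrC.
pose s : loc w := to_loc w x * (to_loc w v * Defs.frac w 1 1).
have us : to_loc w u * s = to_loc w x by rewrite /s mulrCA u_inv mulr1.
have hs : s ^+ n.+1 + \sum_(i < n.+1) to_loc w (c i) * s ^+ i = to_loc w e.
  have inv_n : (to_loc w v * Defs.frac w 1 1) ^+ n.+1 * to_loc w u ^+ n.+1 = 1.
    by rewrite -exprMn mulrC u_inv expr1n.
  rewrite -[LHS]mul1r -inv_n -mulrA.
  rewrite (scale_monic _ (fun i => to_loc w (c i))) us.
  rewrite -[RHS]mul1r -inv_n -mulrA; congr (_ * _).
  have := congr1 (to_loc w) hx; rewrite rmorphM rmorphXn => <-.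
  rewrite rmorphD rmorphXn rmorph_sum; congr (_ + _); apply: eq_bigr => i _.
  by rewrite !rmorphM !rmorphXn.
have [|y gy] := closed s.
  exists n.+1, (fun i => if i is 0 then c 0 - e else c i).
  apply: (addIr (to_loc w e)); rewrite add0r -[RHS]hs.
  by rewrite !big_ord_recl /= rmorphB expr0 !mulr1; ring.
by exists y; apply: inj; rewrite rmorphM gy us.
Qed.

(** * Torsion in the reduction modulo p *)

(** If p = u q, then q has the factor u^(p-1), so q^2 is a multiple of
    u^p (w/u)^p b = p. *)
Lemma torsion_sqr_eq0 (p : nat) (A : comPzRingType) (w u v b : A)
    (x : quo (p%:R : A)) :
  prime p -> GRing.lreg w -> p%:R = w ^+ p * b -> w = u * v ->
  to_quo p%:R u * x = 0 -> x ^+ 2 = 0.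
Proof.
have [d <-] := to_quo_surj x => p_prime w_reg pE wuv.
rewrite -rmorphM -rmorphXn -(rmorph0 (to_quo (p%:R : A))).
move=> /to_quo_eq; rewrite subr0 => /principalP[e he].
apply/to_quo_eq; rewrite subr0; apply/principalP.
have u_reg : GRing.lreg u.
  by move=> a a' h; apply: w_reg; rewrite wuv mulrC mulrA [a * u]mulrC h; ring.
pose m := (p - 2)%N.
have pm : p = m.+2 by rewrite /m -addn2 subnK // prime_gt1.
pose q := u ^+ m.+1 * v ^+ p * b.
have pq : p%:R = u * q.
  by rewrite pE wuv exprMn /q !mulrA -exprS -pm.
have -> : d = q * e by apply: u_reg; rewrite he pq mulrA.
exists (u ^+ m * v ^+ p * b * e ^+ 2).
by rewrite pq /q !exprS; ring.
Qed.

Lemma torsion_expp_eq (p : nat) (A : comPzRingType) (w u v b : A)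
    (x y : quo (p%:R : A)) :
  prime p -> GRing.lreg w -> p%:R = w ^+ p * b -> w = u * v ->
  to_quo p%:R u * x = to_quo p%:R u * y -> x ^+ p = y ^+ p.
Proof.
move=> p_prime w_reg pE wuv uxy.
have /(torsion_sqr_eq0 p_prime w_reg pE wuv) sqr0 :
  to_quo p%:R u * (x - y) = 0 by rewrite mulrBr uxy subrr.
rewrite -{1}(subrK y x) quo_FrobeniusD //.
suff -> : (x - y) ^+ p = 0 by rewrite add0r.
have powS m : (2 <= m)%N -> (x - y) ^+ m = 0.
  by move=> m_ge2; rewrite -(subnK m_ge2) exprD sqr0 mulr0.
exact: powS (prime_gt1 p_prime).
Qed.

(** * The tilt *)

Section Tilt.
Variables (p : nat) (p_prime : prime p) (A : comPzRingType).
Implicit Types x y : tilt p_prime A.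

Definition tilt_coord (n : nat) (x : tilt p_prime A) : quo (p%:R : A) :=
  val x n.

Lemma tilt_coord_is_zmod_morphism n : zmod_morphism (tilt_coord n).
Proof. by move=> x y; rewrite /tilt_coord raddfB. Qed.

Lemma tilt_coord_is_monoid_morphism n : monoid_morphism (tilt_coord n).
Proof.
by split=> [|x y]; rewrite /tilt_coord ?rmorph1 ?rmorphM.
Qed.

HB.instance Definition _ n := GRing.isZmodMorphism.Build
  (tilt p_prime A) (quo (p%:R : A)) (tilt_coord n)
  (tilt_coord_is_zmod_morphism n).
HB.instance Definition _ n := GRing.isMonoidMorphism.Build
  (tilt p_prime A) (quo (p%:R : A)) (tilt_coord n)
  (tilt_coord_is_monoid_morphism n).

Lemma tilt_ext x y : (forall n, tilt_coord n x = tilt_coord n y) -> x = y.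
Proof. by move=> h; apply: val_inj; apply: funext. Qed.

Lemma tilt_coordS n x : tilt_coord n.+1 x ^+ p = tilt_coord n x.
Proof. by case: x => a a_tilt; exact: (elimT (tilt_seqP a) a_tilt). Qed.

Lemma tilt_coordD m n x : tilt_coord (m + n) x ^+ (p ^ m) = tilt_coord n x.
Proof.
elim: m => [|m IH]; first by rewrite expr1.
by rewrite addSn expnS exprM tilt_coordS.
Qed.

End Tilt.

Lemma compatible_rootsD (p : nat) (A : comPzRingType) (w : A) (r : nat -> A)
    (w_roots : compatible_roots p w r) m n : r (m + n)%N ^+ (p ^ m) = r n.
Proof.
case: w_roots => _ rS; elim: m => [|m IH]; first by rewrite expr1.
by rewrite addSn expnS exprM rS.
Qed.

Lemma root_expr_dvd (p : nat) (A : comPzRingType) (w : A) (r : nat -> A)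
    (w_roots : compatible_roots p w r) k n :
  (k <= p ^ n)%N -> exists v, w = r n ^+ k * v.
Proof.
move=> le_k; exists (r n ^+ (p ^ n - k)).
have := compatible_rootsD w_roots n 0; rewrite addn0 w_roots.1 => <-.
by rewrite -exprD subnKC.
Qed.

Section Roots.
Variables (p : nat) (p_prime : prime p) (A : comPzRingType).
Variables (w b : A) (r : nat -> A) (w_roots : compatible_roots p w r).
Hypotheses (w_reg : GRing.lreg w) (p_dvd : p%:R = w ^+ p * b).

Local Notation wt := (tilt_of_roots p_prime w_roots).

Lemma tilt_root_lreg : GRing.lreg wt.
Proof.
move=> x y hxy; apply: tilt_ext => n.
rewrite -(tilt_coordS n x) -(tilt_coordS n y).
have [v wv] : exists v, w = r n.+1 ^+ 1 * v.
  by apply: (root_expr_dvd w_roots); rewrite expn_gt0 prime_gt0.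
apply: (torsion_expp_eq p_prime w_reg p_dvd wv).
by have := congr1 (tilt_coord n.+1) hxy; rewrite !rmorphM expr1.
Qed.

(** The classes of the [H]'s become compatible after one Frobenius; taking
    [p ^ N.+1]-th powers compensates for shifting the indices by [N.+1]. *)
Lemma tilt_dvd_root (k N : nat) (g : tilt p_prime A) :
  (k <= p ^ N)%N ->
  (forall n, (N <= n)%N ->
     exists x, tilt_coord n g = to_quo p%:R (r n) ^+ k * x) ->
  exists h, g = wt ^+ k * h.
Proof.
move=> le_k g_dvd.
have [x xE] := choice (fun n => g_dvd (N + n)%N (leq_addr n N)).
have xS n : x n.+1 ^+ (p * p) = x n ^+ p.
  have [v wv] : exists v, w = r (N + n)%N ^+ k * v.
    apply: (root_expr_dvd w_roots); apply: leq_trans le_k _.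
    by rewrite leq_exp2l ?leq_addr // prime_gt1.
  rewrite exprM; apply: (torsion_expp_eq p_prime w_reg p_dvd wv).
  rewrite rmorphXn -xE -tilt_coordS -addnS xE exprMn.
  by rewrite addnS -(w_roots.2 (N + n)%N) rmorphXn -!exprM [(p * k)%N]mulnC.
have h_tilt : (fun n => x n.+1 ^+ (p ^ N.+1)) \in @tilt_seq p A.
  apply/tilt_seqP => n.
  by rewrite -exprM mulnC !expnS mulnA exprM xS -exprM.
exists (Tilt p_prime h_tilt); apply: tilt_ext => n.
have -> y :
    tilt_coord n (wt ^+ k * y) = to_quo p%:R (r n) ^+ k * tilt_coord n y.
  by rewrite rmorphM rmorphXn.
rewrite -(compatible_rootsD w_roots N.+1 n) -(tilt_coordD N.+1 n g).
by rewrite addSnnS xE exprMn rmorphXn -!exprM mulnC.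
Qed.

End Roots.

Theorem theorem2 (p : nat) (p_prime : prime p) (A : comPzRingType)
    (A_complete : adically_complete (p%:R : A))
    (w : A) (w_nonzerodivisor : GRing.lreg w)
    (r : nat -> A) (w_roots : compatible_roots p w r)
    (p_dvd : exists b : A, p%:R = w ^+ p * b)
    (A_semiperfect : semiperfect p (quo (p%:R : A)))
    (A_closed : integrally_closed_in (to_loc w)) :
  integrally_closed_in (to_loc (tilt_of_roots p_prime w_roots)).
Proof.
case: p_dvd => b pE; set wt := tilt_of_roots p_prime w_roots.
have wt_reg : GRing.lreg wt by apply: tilt_root_lreg pE.
split; first exact: to_loc_inj.
move=> s; have [g [k ->]] := fracP s => /(integral_frac_eq wt_reg).
move=> [d [c hc]].
(* The lifts G are divided from the index k (d + 1) on: it is a convenient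
   N with k (d + 1) <= p^N, so that r_n^(k (d + 1)) divides w for n >= N. *)
have kd_lt : (k * d.+1 < p ^ (k * d.+1))%N by rewrite ltn_expl ?prime_gt1.
suff [h ->] : exists h, g = wt ^+ k * h.
  by exists h; apply: frac_eqW; rewrite expr0 mulr1 mulrC.
apply: (@tilt_dvd_root _ _ _ _ _ _ _ w_nonzerodivisor pE _ (k * d.+1)%N).
  by apply: leq_trans (ltnW kd_lt); rewrite leq_pmulr.
move=> n le_n.
have [G GE] := to_quo_surj (tilt_coord n g).
have [C CE] := choice (fun i => to_quo_surj (tilt_coord n (c i))).
have [v0 wv0] : exists v, w = r n ^+ (k * d.+1) * v.
  apply: (root_expr_dvd w_roots); apply: leq_trans (ltnW kd_lt) _.
  by rewrite leq_exp2l ?prime_gt1.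
have wv : w = r n ^+ k * ((r n ^+ k) ^+ d * v0).
  by rewrite mulrA -exprS -exprM.
(* The lifted equation holds up to a multiple of p, hence of w, hence of
   (r_n^k)^(d + 1). *)
have [e he] : exists e, G ^+ d.+1
    + \sum_(i < d.+1) C i * (r n ^+ k) ^+ (d.+1 - i) * G ^+ i = p%:R * e.
  apply/principalP; rewrite -[X in X \in _]subr0; apply/to_quo_eq.
  have := congr1 (tilt_coord n) hc; rewrite [RHS]rmorph0 => eq_n.
  rewrite [RHS]rmorph0 -[RHS]eq_n.
  rewrite !rmorphD !rmorphXn !rmorph_sum.
  congr (_ ^+ _ + _); first exact: GE.
  apply: eq_bigr => i _; rewrite !rmorphM !rmorphXn.
  by congr (_ * _ * _ ^+ _); [exact: CE | exact: GE].
have pw : p%:R = w * (w ^+ p.-1 * b).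
  by rewrite pE mulrA -exprS prednK // prime_gt0.
rewrite pw {1}wv0 exprM -!mulrA in he.
have [H HE] := integral_dvd A_closed wv he.
by exists (to_quo p%:R H); rewrite -GE HE rmorphM rmorphXn.
Qed.
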